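(* There exists a family of graphs $\{G_k\}_{k\in\mathbb{Z}^+}$ with $\operatorname{bdim}(G_k)=\Theta(k)$ and $\operatorname{adim}(G_k)=2^{\Omega(k)}$ for every $k\in\mathbb{Z}^+$.
   Context: All graphs are finite, simple and undirected. $d(u,v)$ is graph distance and $d_k(u,v)=\min\{d(u,v),k+1\}$. A function $f:V(G)\to\mathbb{Z}_{\ge0}$ is a resolving broadcast if for any distinct $x,y$ there is $z$ with $f(z)>0$ and $d_{f(z)}(x,z)\ne d_{f(z)}(y,z)$; $\operatorname{bdim}(G)$ is the minimum of $\sum_v f(v)$ over resolving broadcasts. A set $A\subseteq V(G)$ is an adjacency resolving set if for any distinct $x,y$ there is $z\in A$ with $d_1(x,z)\ne d_1(y,z)$; $\operatorname{adim}(G)$ is the minimum size of such a set. *)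

(* Defs.v *)
From HB Require Import structures.
From mathcomp Require Import all_boot all_order all_algebra.
From mathcomp Require Import boolp reals exp.

Set Implicit Arguments.
Unset Strict Implicit.
Unset Printing Implicit Defensive.

Import Order.TTheory GRing.Theory Num.Theory.

Record sgraph := SGraph {
  vertex :> finType;
  adj : rel vertex;
  adj_sym : symmetric adj;
  adj_irrefl : irreflexive adj }.

Definition walk (G : sgraph) (u v : G) (n : nat) : bool :=
  [exists p : n.-tuple G, path (@adj G) u p && (last u p == v)].

(* Graphs need not be connected: [None] stands for an infinite distance.  A
   shortest walk repeats no vertex, so lengths below #|G| suffice; see
   [dist_someP] and [dist_noneP]. *)
Definition dist (G : sgraph) (u v : G) : option nat :=
  ohead [seq n <- iota 0 #|{: G}| | walk u v n].

(* min (d (u, v), k + 1) *)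
Definition dist_trunc (G : sgraph) (k : nat) (u v : G) : nat :=
  if dist u v is Some n then minn n k.+1 else k.+1.

Definition resolving_broadcast (G : sgraph) (f : G -> nat) : bool :=
  [forall x : G, forall y : G, (x != y) ==>
    [exists z : G, (0 < f z) &&
       (dist_trunc (f z) x z != dist_trunc (f z) y z)]].

Definition adjacency_resolving (G : sgraph) (A : {set G}) : bool :=
  [forall x : G, forall y : G, (x != y) ==>
    [exists z in A, dist_trunc 1 x z != dist_trunc 1 y z]].

Lemma walkP (G : sgraph) (u v : G) (n : nat) :
  reflect (exists2 p : seq G, path (@adj G) u p /\ last u p = v & size p = n)
          (walk u v n).
Proof.
apply: (iffP existsP) => [[p /andP[pP /eqP pl]]|[p [pP pl] /eqP sp]].
  by exists p; rewrite ?size_tuple.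
by exists (Tuple sp); rewrite /= pP pl eqxx.
Qed.

Lemma walk_shorten (G : sgraph) (u v : G) (n : nat) :
  walk u v n -> exists2 m, walk u v m & (m <= n) && (m < #|{: G}|).
Proof.
case/walkP=> p [pP <-] <-; case/shortenP: pP => p' p'P p'U sub.
exists (size p'); first by apply/walkP; exists p'.
apply/andP; split.
  by apply: uniq_leq_size => //; case/andP: p'U.
by rewrite -[_.+1]/(size (u :: p')) -(card_uniqP p'U) max_card.
Qed.

Lemma ohead_filter_iota (P : pred nat) (s m n : nat) :
  ohead [seq i <- iota s m | P i] = Some n <->
  [/\ P n, s <= n < s + m & forall i, s <= i -> P i -> n <= i].
Proof.
elim: m s => [|m IH] s /=.
  by split=> // -[_]; rewrite addn0 => /andP[a]; rewrite ltnNge a.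
case: ifP => Ps /=; split.
- by case=> <-; split; rewrite // leqnn addnS ltnS leq_addr.
- case=> _ /andP[sn _] /(_ s (leqnn s) Ps) ns.
  by congr Some; apply/eqP; rewrite eqn_leq sn ns.
- move/IH=> [Pn /andP[sn nm] mn]; split=> //.
    by rewrite (ltnW sn) -addSnnS nm.
  move=> i; rewrite leq_eqVlt => /orP[/eqP <-|]; first by rewrite Ps.
  exact: mn.
case=> Pn /andP[sn nm] mn; apply/IH; split=> //; last first.
  by move=> i /ltnW; exact: mn.
rewrite addSnnS nm andbT ltn_neqAle sn andbT.
by apply/eqP=> sE; rewrite sE Pn in Ps.
Qed.

Lemma dist_someP (G : sgraph) (u v : G) (n : nat) :
  dist u v = Some n <-> walk u v n /\ (forall m, walk u v m -> n <= m).
Proof.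
rewrite /dist; split=> [/ohead_filter_iota[wn _ mn]|[wn mn]].
  by split=> // m; exact: mn.
apply/ohead_filter_iota; split=> // [|m _]; last exact: mn.
have [m /mn nm /andP[_ mG]] := walk_shorten wn.
by rewrite add0n; exact: leq_ltn_trans nm mG.
Qed.

Lemma dist_noneP (G : sgraph) (u v : G) :
  dist u v = None <-> ~~ connect (@adj G) u v.
Proof.
split=> [dN|nc].
  apply/connectP=> -[p pP vE].
  have /walk_shorten[m wm /andP[_ mG]] : walk u v (size p).
    by apply/walkP; exists p.
  have : m \in [seq n <- iota 0 #|{: G}| | walk u v n].
    by rewrite mem_filter wm mem_iota.
  by move: dN; rewrite /dist; case: [seq _ <- _ | _].
case dE : (dist u v) => [n|//]; case/dist_someP: dE => /walkP[p [pP vE] _] _.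
by case/connectP: nc; exists p.
Qed.

Lemma dist_trunc_self (G : sgraph) (k : nat) (u : G) : dist_trunc k u u = 0.
Proof.
rewrite /dist_trunc (_ : dist u u = Some 0) ?min0n //.
by apply/dist_someP; split=> //; apply/walkP; exists [::].
Qed.

Lemma dist_trunc_neq (G : sgraph) (k : nat) (u v : G) :
  u != v -> dist_trunc k u v != 0.
Proof.
rewrite /dist_trunc; case dE: (dist u v) => [[|n]|] //; last by rewrite minnSS.
case/dist_someP: dE => /walkP[p [_ pl] /eqP]; rewrite size_eq0 => /eqP p0 _.
by rewrite -pl p0 /= eqxx.
Qed.

Lemma adjacency_resolving_setT (G : sgraph) :
  adjacency_resolving [set: G].
Proof.
apply/'forall_'forall_implyP=> x y xy; apply/existsP; exists x.
by rewrite inE /= dist_trunc_self eq_sym dist_trunc_neq // eq_sym.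
Qed.

Lemma resolving_broadcast_exists (G : sgraph) :
  exists n, `[< exists f : G -> nat,
                 resolving_broadcast f /\ \sum_v f v = n >].
Proof.
exists (\sum_(v : G) 1); apply/asboolP; exists (fun=> 1); split=> //.
apply/'forall_'forall_implyP=> x y xy; apply/existsP; exists x.
by rewrite /= dist_trunc_self eq_sym dist_trunc_neq // eq_sym.
Qed.

Definition bdim (G : sgraph) : nat := ex_minn (resolving_broadcast_exists G).

(* [set: G] is resolving ([adjacency_resolving_setT]), so the minimum is
   attained at a resolving set. *)
Definition adim (G : sgraph) : nat :=
  #|[arg min_(A < [set: G] | adjacency_resolving A) #|A| ]|.

Local Open Scope ring_scope.

(* Asymptotic comparison of sequences indexed by the positive integers, with
   constants valid at every index k >= 1. *)
Definition bigO (R : realType) (f g : nat -> R) : Prop :=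
  exists2 c : R, 0 < c & forall k : nat, (0 < k)%N -> f k <= c * g k.

Definition bigOmega (R : realType) (f g : nat -> R) : Prop :=
  exists2 c : R, 0 < c & forall k : nat, (0 < k)%N -> c * g k <= f k.

Definition bigTheta (R : realType) (f g : nat -> R) : Prop :=
  bigO f g /\ bigOmega f g.

(* Main.v *)
Require Import Defs.
From mathcomp Require Import all_boot all_order all_algebra.
From mathcomp Require Import reals exp.

Set Implicit Arguments.
Unset Strict Implicit.
Unset Printing Implicit Defensive.

Import Order.TTheory GRing.Theory Num.Theory.

(** Take a clique with vertices (i, S), i < m, for every subset S of
    {0, ..., m-1}, and join (i, S) to a landmark (i, [i \in S]).  The vertex
    (i, S) is adjacent to a single landmark, and the landmarks within distance
    2 of it spell out S; so strength 2 at each of the 2m landmarks gives a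
    resolving broadcast of cost 4m.  At distance 1, on the other hand, the
    vertices (0, S) with a given value of [0 \in S] see the same landmarks,
    so all but at most one of the corresponding cliques must meet an adjacency
    resolving set.  Conversely, a broadcast of cost b distinguishes at most
    4^b vertices, so b is at least linear in m. *)

(** * Walks and truncated distances *)

Lemma walk0 (G : sgraph) (u v : G) : walk u v 0 = (u == v).
Proof.
apply/walkP/eqP => [[p [_ <-] /size0nil ->] // | ->].
by exists [::].
Qed.

Lemma walkS (G : sgraph) (u v : G) n :
  walk u v n.+1 = [exists w, adj u w && walk w v n].
Proof.
apply/walkP/existsP => [[[//|w p] /= [/andP[uw wp] lp] [sp]] | [w /andP[uw]]].
  by exists w; rewrite uw; apply/walkP; exists p.
by case/walkP=> p [wp lp] sp; exists (w :: p); rewrite /= ?uw ?sp.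
Qed.

Lemma walk1 (G : sgraph) (u v : G) : walk u v 1 = adj u v.
Proof.
rewrite walkS; apply/existsP/idP => [[w] | uv].
  by rewrite walk0 => /andP[uw /eqP <-].
by exists v; rewrite uv walk0 eqxx.
Qed.

(** Truncation happens at [k.+1], hence is invisible to thresholds [n <= k]; distances can then be
    compared by exhibiting or excluding short walks. *)
Lemma dist_trunc_leP (G : sgraph) k (u v : G) n : (n <= k) ->
  reflect (exists2 m, (m <= n) & walk u v m) (dist_trunc k u v <= n).
Proof.
move=> nk; rewrite /dist_trunc; apply: (iffP idP).
  case dE: (dist u v) => [d|]; last by rewrite leqNgt ltnS nk.
  rewrite geq_min (leqNgt k.+1) ltnS nk orbF => dn.
  by case/dist_someP: dE => wd _; exists d.
case=> m mn wm; case dE: (dist u v) => [d|].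
  case/dist_someP: dE => _ /(_ m wm) dm.
  by rewrite geq_min (leq_trans dm mn).
move/dist_noneP: dE => /connectP[]; case/walkP: wm => p [pp pl] _.
by exists p.
Qed.

Lemma dist_trunc_le (G : sgraph) k (u v : G) : (dist_trunc k u v <= k.+1).
Proof. by rewrite /dist_trunc; case: dist => // d; rewrite geq_minr. Qed.

Lemma dist_trunc1E (G : sgraph) (u v : G) :
  dist_trunc 1 u v = if u == v then 0 else if adj u v then 1 else 2.
Proof.
have [->|uv] := eqVneq u v; first exact: dist_trunc_self.
have := dist_trunc_neq 1 uv; have := dist_trunc_le 1 u v.
have [+ +] := rwP (@dist_trunc_leP G 1 u v 1 (leqnn _)).
case: dist_trunc => [|[|[|//]]] //= => [_ | nw _ _ _].
  case=> // -[|[|//]] _; first by rewrite walk0 (negPf uv).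
  by rewrite walk1 => ->.
case: ifP => // uva.
by have // : 1 < 1; apply: nw; exists 1; rewrite ?walk1.
Qed.

(** * Broadcasts and the order of a graph *)

Lemma bdim_attained (G : sgraph) :
  exists2 f : G -> nat, resolving_broadcast f & (\sum_v f v = bdim G).
Proof. by rewrite /bdim; case: ex_minnP => n /boolp.asboolP[f [fr fs]] _; exists f. Qed.

Lemma bdim_min (G : sgraph) (f : G -> nat) :
  resolving_broadcast f -> (bdim G <= \sum_v f v).
Proof.
move=> fr; rewrite /bdim; case: ex_minnP => n _; apply.
by apply/boolp.asboolP; exists f.
Qed.

(** A vertex is determined by its truncated distances to the [z] with [f z > 0]. Each takes at most
    [f z + 2 <= 4 ^ f z] values, and the product of these bounds is 4 to the cost of [f]. *)
Lemma card_le_exp_bdim (G : sgraph) : (#|G| <= 4 ^ bdim G).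
Proof.
have [f fr <-] := bdim_attained G.
pose N := (4 ^ \sum_v f v).
have le_N z : (4 ^ f z <= N).
  by rewrite leq_pexp2l // (bigD1 z) //= leq_addr.
(* The constant 0 where [f z = 0] leaves a single value there, matching [4 ^ 0]. *)
pose val x z := if f z == 0 then 0 else dist_trunc (f z) x z.
have val_lt x z : (val x z < 4 ^ f z).
  rewrite /val; case: (f z) => [|n] //=.
  apply: leq_ltn_trans (dist_trunc_le _ _ _) _.
  elim: n => // n IH; rewrite expnS; apply: leq_ltn_trans IH _.
  by rewrite ltn_Pmull // expn_gt0.
(* All coordinates share the codomain ['I_N] to form a finite function; [F] restores the bound of
   each coordinate. *)
pose c x := [ffun z => Ordinal (leq_trans (val_lt x z) (le_N z))].
have c_inj : injective c.
  move=> x y cxy; apply/eqP; apply: contraT => xy.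
  have /existsP[z /andP[fz]] := implyP (forallP (forallP fr x) y) xy.
  move/ffunP/(_ z)/(congr1 (@nat_of_ord _)): cxy.
  by rewrite !ffunE /= /val -(negbK (f z == _)) -lt0n fz /= => ->; rewrite eqxx.
pose F z := [pred i : 'I_N | (i < 4 ^ f z)].
have cF : [set c x | x : G] \subset family F.
  apply/subsetP => _ /imsetP[x _ ->]; apply/familyP => z.
  by rewrite ffunE inE /= val_lt.
rewrite -(card_imset _ c_inj); apply: leq_trans (subset_leq_card cF) _.
rewrite card_family foldrE big_map big_enum expn_sum.
apply: leq_prod => z _.
by rewrite -sum1_card (big_ord_narrow (le_N z)) sum1_card card_ord.
Qed.

Lemma adim_attained (G : sgraph) :
  exists2 A : {set G}, adjacency_resolving A & #|A| = adim G.
Proof.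
rewrite /adim; case: arg_minnP => [|A Ar _]; first exact: adjacency_resolving_setT.
by exists A.
Qed.

(** * The cliques and their landmarks *)

Section CliqueGraph.
Variable m : nat.

Definition clique_vertex : finType := (('I_m * {set 'I_m}) + ('I_m * bool))%type.

Definition clique_adj (u v : clique_vertex) : bool :=
  match u, v with
  | inl (i, s), inl (j, t) => (i != j) && (s == t)
  | inl (i, s), inr (j, b) => (i == j) && ((i \in s) == b)
  | inr (j, b), inl (i, s) => (i == j) && ((i \in s) == b)
  | inr _, inr _ => false
  end.

Lemma clique_adj_sym : symmetric clique_adj.
Proof. by move=> [[i s]|[i b]] [[j t]|[j c]] //=; rewrite eq_sym [t == s]eq_sym. Qed.

Lemma clique_adj_irrefl : irreflexive clique_adj.
Proof. by move=> [[i s]|[i b]] //=; rewrite eqxx. Qed.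

Definition clique_graph : sgraph := SGraph clique_adj_sym clique_adj_irrefl.

Definition member (i : 'I_m) (s : {set 'I_m}) : clique_graph := inl (i, s).
Definition landmark (i : 'I_m) (b : bool) : clique_graph := inr (i, b).

(** Move inside the clique of [s] to its [j]-th vertex, then to the landmark of that vertex. *)
Lemma walk2_landmark i s j :
  exists2 n, n <= 2 & walk (member i s) (landmark j (j \in s)) n.
Proof.
have [->|ij] := eqVneq i j.
  by exists 1; rewrite // walk1 /= !eqxx.
exists 2 => //; rewrite walkS; apply/existsP; exists (member j s).
by rewrite walk1 /= ij !eqxx.
Qed.

(** Landmarks are pairwise non-adjacent, so the midpoint of a walk of length 2 is a clique vertex,
    and it lies in the clique of [s]. *)
Lemma walk2_landmarkE i s j b n :
  n <= 2 -> walk (member i s) (landmark j b) n -> b = (j \in s).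
Proof.
case: n => [|[|[|//]]] _; first by rewrite walk0.
  by rewrite walk1 /= => /andP[/eqP <- /eqP].
rewrite walkS => /existsP[[[k t]|[k c]]]; rewrite walk1 /= ?andbF //.
by case/andP=> /andP[_ /eqP ->] /andP[/eqP -> /eqP].
Qed.

Definition landmark_broadcast (v : clique_graph) : nat := if v is inr _ then 2 else 0.

(** Threshold 0 singles out a landmark, threshold 1 separates clique vertices of different index,
    and threshold 2 separates those of equal index, at a landmark given by an element of exactly one
    of the two sets. *)
Lemma landmark_broadcast_resolving : resolving_broadcast landmark_broadcast.
Proof.
have sep (x y : clique_graph) j b n : n <= 2 ->
    (dist_trunc 2 x (landmark j b) <= n) != (dist_trunc 2 y (landmark j b) <= n) ->
    [exists z, (0 < landmark_broadcast z) &&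
      (dist_trunc (landmark_broadcast z) x z != dist_trunc (landmark_broadcast z) y z)].
  move=> n2 xy; apply/existsP; exists (landmark j b) => /=.
  by apply: contraNneq xy => ->.
apply/'forall_'forall_implyP => x y.
case: x y => [[i s]|[i b]] [[j t]|[j c]] xy; last 1 first.
- apply: (sep _ _ i b 0) => //; rewrite !leqn0 dist_trunc_self.
  by rewrite (negPf (dist_trunc_neq _ _)) // eq_sym.
- have [ij|ij] := eqVneq i j.
    have /eqP/setP ST : s != t by apply: contraNneq xy => ->; rewrite ij.
    have /existsP[l lST] : [exists l, (l \in s) != (l \in t)].
      apply: contraT; rewrite negb_exists => /forallP nST.
      by case: ST => l; apply/eqP; rewrite -[_ == _]negbK nST.
    apply: (sep _ _ l (l \in s) 2) => //.
    have -> : dist_trunc 2 (member i s) (landmark l (l \in s)) <= 2.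
      by apply/dist_trunc_leP => //; exact: walk2_landmark.
    have -> : (dist_trunc 2 (member j t) (landmark l (l \in s)) <= 2) = false.
      by apply/dist_trunc_leP => // -[n n2 /(walk2_landmarkE n2)]; apply/eqP.
    by [].
  apply: (sep _ _ i (i \in s) 1) => //.
  have -> : dist_trunc 2 (member i s) (landmark i (i \in s)) <= 1.
    by apply/dist_trunc_leP => //; exists 1; rewrite ?walk1 //= !eqxx.
  have -> : (dist_trunc 2 (member j t) (landmark i (i \in s)) <= 1) = false.
    apply/dist_trunc_leP => // -[[|[|//]] _]; first by rewrite walk0.
    by rewrite walk1 /= eq_sym (negPf ij).
  by [].
- apply: (sep _ _ j c 0) => //; rewrite !leqn0 dist_trunc_self.
  by rewrite (negPf (dist_trunc_neq _ _)).
- apply: (sep _ _ i b 0) => //; rewrite !leqn0 dist_trunc_self.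
  by rewrite (negPf (dist_trunc_neq _ _)).
Qed.

Lemma bdim_clique_graph_le : bdim clique_graph <= 4 * m.
Proof.
apply: leq_trans (bdim_min landmark_broadcast_resolving) _.
rewrite big_sumType /= big1 // add0n sum_nat_const card_prod card_ord card_bool.
by rewrite -mulnA mulnC.
Qed.

Lemma card_clique_graph : 0 < m -> 2 ^ m <= #|clique_graph|.
Proof.
move=> m_gt0; rewrite card_sum card_prod card_ord -cardsT -powersetT card_powerset.
rewrite cardsT card_ord; apply: leq_trans (leq_addr _ _).
by rewrite leq_pmull.
Qed.

Lemma adim_clique_graph_ge : 0 < m -> 2 ^ m <= (adim clique_graph).+2.
Proof.
move=> m_gt0; have [A Ar <-] := adim_attained clique_graph.
pose i0 := Ordinal m_gt0.
pose B := [set s | [exists i, member i s \in A]].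
have leB : #|B| <= #|A|.
  (* Only [B] being contained in the image of [A] matters, so landmarks may go to [set0]. *)
  pose g (z : clique_graph) := if z is inl p then p.2 else set0.
  apply: leq_trans (leq_imset_card g A); apply: subset_leq_card.
  by apply/subsetP => s; rewrite inE => /existsP[i iA]; apply/imsetP; exists (member i s).
(* A clique vertex in [A] lies in neither clique, so it is at truncated distance 2 from both
   vertices of index [i0]; a landmark sees only whether [i0] belongs to the set. *)
have injB : {in ~: B &, injective (fun s : {set 'I_m} => i0 \in s)}.
  move=> s t; rewrite !inE => nS nT ST; apply/eqP; apply: contraT => neST.
  have neq : member i0 s != member i0 t by apply: contraNneq neST => -[->].
  have /existsP[z /andP[zA]] := implyP (forallP (forallP Ar _) _) neq.
  have out j u : ~~ [exists i, member i u \in A] -> z = member j u -> False.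
    by move=> /existsP nU zE; case: nU; exists j; rewrite -zE.
  rewrite !dist_trunc1E; case: z {zA} out => [[j u]|[j b]] out /=; last first.
    by rewrite ST eqxx.
  have [SU|SU] := eqVneq s u; first by case: (out j s nS); rewrite SU.
  have [TU|TU] := eqVneq t u; first by case: (out j t nT); rewrite TU.
  have inlE V : V != u -> (inl (i0, V) == inl (j, u) :> clique_vertex) = false.
    by move=> VU; apply/negbTE; apply: contraNneq VU => -[_ ->].
  by rewrite !inlE // !andbF eqxx.
have leC : #|~: B| <= 2.
  by rewrite -(card_in_imset injB) -card_bool max_card.
have := cardsC B; rewrite -cardsT -powersetT card_powerset cardsT card_ord => <-.
by rewrite -addn2 leq_add.
Qed.

End CliqueGraph.

Local Open Scope ring_scope.

Theorem theorem5p1 (R : realType) :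
  exists G : nat -> sgraph,
    bigTheta (fun k : nat => (bdim (G k))%:R : R) (fun k : nat => k%:R) /\
    (exists h : nat -> R,
      bigOmega h (fun k : nat => k%:R) /\
      (forall k : nat, (0 < k)%N -> (adim (G k))%:R = 2 `^ h k)).
Proof.
(* The shift gives [2 ^ k.+1 - 2 >= 2 ^ k] for all [k >= 1]; unshifted, the lower bound would vanish
   at [k = 1]. *)
exists (fun k => clique_graph k.+1); split; first split.
(* [4 * (k + 1) <= 8 * k] since [k >= 1]. *)
- exists 8%:R => // k k_gt0; rewrite -natrM ler_nat.
  apply: leq_trans (bdim_clique_graph_le _) _.
  by rewrite -[8%N]/(4 * 2)%N -mulnA leq_mul2l mul2n -addnn -(addn1 k) leq_add2l.
(* From [2 ^ k.+1 <= 4 ^ b = 2 ^ (2 * b)], where [b] is the broadcast dimension. *)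
- exists 2^-1 => [|k k_gt0]; first by rewrite invr_gt0.
  rewrite ler_pdivrMl // -natrM ler_nat.
  apply: leq_trans (leqnSn k) _; rewrite -(@leq_exp2l 2) // expnM.
  exact: leq_trans (card_clique_graph _) (card_le_exp_bdim _).
have ln2_gt0 : 0 < ln (2 : R) by rewrite ln_gt0 // ltr1n.
have adim_ge k : (0 < k)%N -> (2 ^ k <= adim (clique_graph k.+1))%N.
  case: k => // k _; rewrite -(leq_add2r 2) (addn2 (adim _)).
  apply: leq_trans (adim_clique_graph_ge (ltn0Sn _)).
  rewrite [leqRHS]expnS mul2n -addnn leq_add2l.
  by rewrite expnS leq_pmulr // expn_gt0.
(* The exact base-2 logarithm of the adjacency dimension, which is positive by [adim_ge]. *)
exists (fun k => ln (adim (clique_graph k.+1))%:R / ln 2); split.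
  exists 1 => // k k_gt0; rewrite mul1r ler_pdivlMr // mulr_natl -lnXn //.
  rewrite ler_ln ?posrE ?exprn_gt0 // -?natrX ?ler_nat ?adim_ge //.
  by rewrite ltr0n (leq_trans _ (adim_ge k k_gt0)) ?expn_gt0.
move=> k k_gt0; rewrite /powR pnatr_eq0 /= divfK ?gt_eqF // lnK // posrE ltr0n.
by rewrite (leq_trans _ (adim_ge k k_gt0)) ?expn_gt0.
Qed.
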